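(* Let $P_1,P_2,\dots,P_k$ be complex polynomials of degree at least two, and let $S=\langle P_1,P_2,\dots,P_k\rangle$ be the semigroup under composition generated by them. Then $S$ is isomorphic (as a semigroup) to a subsemigroup of $\mathcal{Z}^U$ if and only if $SP_1\cap SP_2\cap\dots\cap SP_k\neq\emptyset$.
   Context: $\langle P_1,\dots,P_k\rangle$ denotes the semigroup consisting of all compositions of finite non-empty words in $P_1,\dots,P_k$; the semigroup operation is composition of polynomials. $\mathcal{Z}^U$ denotes the semigroup, under composition, of all polynomials of the form $\omega z^n$, where $\omega\in\mathbb{C}$ is a root of unity and $n\ge 1$ is an integer. For $P\in S$, $SP=\{A\circ P : A\in S\}$ (called in the paper a principal right ideal). *)

(* Defs.v *)
From mathcomp Require Import all_boot all_algebra.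
From mathcomp Require Import complex.
From mathcomp Require Import classical_sets functions reals.

Set Implicit Arguments.
Unset Strict Implicit.
Unset Printing Implicit Defensive.

Import GRing.Theory.
Local Open Scope classical_set_scope.
Local Open Scope ring_scope.

Section PolySemigroups.
Variable C : fieldType.
Implicit Types (A B P : {poly C}) (S T : set {poly C}).

(* P_(i_1) \Po (P_(i_2) \Po ... \Po P_(i_m)) for the word i_1 ... i_m; the
   innermost 'X is the identity map. *)
Definition comp_word k (P : 'I_k -> {poly C}) (w : seq 'I_k) : {poly C} :=
  foldr (fun i A => P i \Po A) 'X w.

Definition gen_semigroup k (P : 'I_k -> {poly C}) : set {poly C} :=
  [set comp_word P w | w in [set w | w <> [::]]].

(* The condition 0 < m is needed: every x satisfies 0.-unity_root x. *)
Definition is_root_of_unity (x : C) : Prop :=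
  exists2 m : nat, (0 < m)%N & m.-unity_root x.

Definition ZU : set {poly C} :=
  [set A | exists (omega : C) (n : nat),
     [/\ is_root_of_unity omega, (1 <= n)%N & A = omega *: 'X^n]].

Definition comp_closed S : Prop :=
  forall A B, S A -> S B -> S (A \Po B).

Definition subsemigroup T S : Prop :=
  [/\ T !=set0, T `<=` S & comp_closed T].

(* Only the values of phi on S matter. *)
Definition semigroup_isomorphic S T : Prop :=
  exists phi : {poly C} -> {poly C},
    set_bij S T phi /\
    (forall A B, S A -> S B -> phi (A \Po B) = phi A \Po phi B).

Definition principal_right_ideal S P : set {poly C} :=
  [set A \Po P | A in S].

End PolySemigroups.

Arguments ZU C : clear implicits.

(* Main.v *)
Require Import Defs.
From mathcomp Require Import all_boot all_order all_algebra.
From mathcomp Require Import complex.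
From mathcomp Require Import classical_sets functions reals.
From mathcomp Require Import ring lra zify.

(** For nonconstant polynomials,
    the top term of A o B is the composite of the top terms.  So sending such a
    polynomial to its top monomial is always a homomorphism to the monomials
    a X^n, and when the generators have a common left multiple
    F = A_i o P_i two points remain: this homomorphism is injective on S
    (rigidity), and one rescaling of the variable turns all its coefficients
    into roots of unity (torsion).

    Rigidity.  Compare two polynomials through their normalized logarithmic
    derivatives at infinity: A and B agree to order r when
    A'/(deg A * A) - B'/(deg B * B) = O(z^(-r-1)), i.e. when log A / deg A and
    log B / deg B differ by a constant plus O(z^(-r)).  This relation is
    transitive; composing on the right with P multiplies the order by deg P;
    and U o A agrees with A to order deg A, whatever U is.  Hence a bootstrap
    (gen_semigroup_agree): every A in S agrees to high order with some
    G o A = (G o A_0) o P_i, and if all elements of S of degree at least r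
    agree to order r, then so do G o A_0 and G o A_i, hence G o A and
    G o F = (G o A_i) o P_i agree to order r * deg P_i > r.  Thus any two
    elements of S agree to the order of the smaller degree; when degree and
    leading coefficient coincide this leaves a constant difference, and
    composing once more on the left kills it (gen_semigroup_rigid).

    Torsion.  Taking logarithms of coefficients, c X^n becomes the affine map
    x |-> n x + log c, and rescaling the variable is a translation.  In an
    ordered field, the equations A_i o P_i = F force all these expanding
    affine maps to have the same fixed point (affine_word_common): no
    letter brings a point from outside the interval spanned by the fixed points
    back into it, so the preimage of the interval under F lies in its preimage
    under each P_i; but the preimages attached to the two extreme fixed points
    sit at the two ends and have at most half the length, whereas the preimage
    under F has positive length.  This holds for rational
    unknowns, so over rat the equations
    (n_j - 1) g_i = (n_i - 1) g_j are linear consequences of the equations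
    that express A_i o P_i = F.  Clearing denominators and exponentiating,
    c_i^(n_j - 1) and c_j^(n_i - 1) agree up to a root of unity
    (lead_coef_torsion).

    Conversely, in a semigroup of monomials whose coefficients are roots of
    unity any two elements A, B have a common left multiple: A o B and B o A
    have the same degree N, and powers of them commute once they are composed
    on the left with an element of degree N^s for which N^s absorbs the
    degree of those powers modulo the order of the coefficients
    (monomial_common_left_multiple).  Common left multiples of pairs give
    common left multiples of finite families. *)

Set Implicit Arguments.
Unset Strict Implicit.
Unset Printing Implicit Defensive.

Import Order.TTheory GRing.Theory Num.Theory.
Local Open Scope classical_set_scope.
Local Open Scope ring_scope.

(* Lemmas stated for different algebraic structures produce syntactically
   different copies of the size of one polynomial; abstracting every size up to
   conversion identifies them before arithmetic is called. *)
Ltac slia :=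
  repeat match goal with H : is_true _ |- _ => move: H end;
  repeat match goal with H : @eq nat _ _ |- _ => move: H end;
  repeat match goal with |- context [@size ?T ?s] =>
    let n := fresh "n" in set n := (@size T s); move: n end;
  (lia || nia).

Local Notation deg p := (size p).-1.

(** * Agreement of polynomials at infinity *)

Section LogarithmicAgreement.
Variable K : numFieldType.
Implicit Types (A B D P U : {poly K}) (r : nat).

Lemma size_natmul_poly n P : (0 < n)%N -> size (n%:R * P)%R = size P.
Proof.
by move=> n0; rewrite mulr_natl -scaler_nat size_scale // pnatr_eq0 -lt0n.
Qed.

Lemma size_natmul_poly_leq n P : (size (n%:R * P)%R <= size P)%N.
Proof. by rewrite mulr_natl -scaler_nat size_scale_leq. Qed.

Lemma size_deriv_leq P : (size P^`() <= deg P)%N.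
Proof.
have [->|/lt_size_deriv] := eqVneq P 0; first by rewrite deriv0 size_poly0.
by slia.
Qed.

Lemma size_deriv_num P : size P^`() = deg P.
Proof.
have [P1|P2] := leqP (size P) 1.
  by apply/eqP; rewrite eqn_leq size_deriv_leq; slia.
apply/eqP; rewrite eqn_leq size_deriv_leq /= leqNgt; apply/negP => sP'.
have /leq_sizeP /(_ _ (leqnn _))/eqP : (size P^`() <= (deg P).-1)%N.
  by slia.
rewrite coef_deriv.
have -> : (deg P).-1.+1 = deg P by slia.
rewrite -mulr_natr mulf_eq0 pnatr_eq0 -/(lead_coef P) lead_coef_eq0 -size_poly_eq0.
slia.
Qed.

(** This is deg A * deg B * A * B times the difference of the normalized
    logarithmic derivatives A'/(deg A * A) and B'/(deg B * B); its terms of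
    degree deg A + deg B - 1 cancel. *)
Definition logdiff A B : {poly K} :=
  (deg B)%:R * (A^`() * B) - (deg A)%:R * (A * B^`()).

(** Agreement to order r at infinity: the difference of normalized logarithmic
    derivatives is O(z^(-r-1)).  The additive form makes the bound a genuine
    constraint on r also when logdiff A B = 0. *)
Definition agree r A B : Prop := (size (logdiff A B) + r <= deg A + deg B)%N.

Lemma agree_sym r A B : agree r A B -> agree r B A.
Proof.
rewrite /agree; have -> : logdiff B A = - logdiff A B by rewrite /logdiff; ring.
by rewrite size_polyN addnC; slia.
Qed.

Lemma agree_leq r s A B : (r <= s)%N -> agree s A B -> agree r A B.
Proof. by rewrite /agree; slia. Qed.

(** The normalized logarithmic derivatives are subtracted; clearing
    denominators gives
    deg B * B * W(A,D) = deg D * D * W(A,B) + deg A * A * W(B,D)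
    for W = logdiff. *)
Lemma agree_trans r A B D : (0 < deg B)%N -> (r <= deg A)%N ->
  agree r A B -> agree r B D -> agree r A D.
Proof.
move=> B0 rA AB BD; rewrite /agree.
have [->|W0] := eqVneq (logdiff A D) 0; first by rewrite size_poly0; slia.
have E : (deg B)%:R * (B * logdiff A D) =
   (deg D)%:R * (D * logdiff A B) + (deg A)%:R * (A * logdiff B D).
  by rewrite /logdiff; ring.
have Bn0 : B != 0 by rewrite -size_poly_eq0; slia.
have : (size (B * logdiff A D)%R <= deg A + deg B + deg D - r)%N.
  rewrite -(size_natmul_poly _ B0) E (leq_trans (size_polyD _ _)) // geq_max.
  move: AB BD; rewrite /agree => AB BD.
  by apply/andP; split; rewrite (leq_trans (size_natmul_poly_leq _ _)) //;
    rewrite (leq_trans (size_polyMleq _ _)) //; slia.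
have := W0; rewrite -size_poly_eq0 size_mul //; slia.
Qed.

(** Substituting P turns O(z^(-r)) into O(z^(-r * deg P)); for logdiff, the
    chain rule produces one common factor P'.  This gain is what drives the
    bootstrap. *)
Lemma agree_precomp r A B P : (0 < deg P)%N ->
  agree r A B -> agree (r * deg P) (A \Po P) (B \Po P).
Proof.
move=> P0; rewrite /agree !size_comp_poly => AB.
have -> : logdiff (A \Po P) (B \Po P) =
    (deg P)%:R * ((logdiff A B \Po P) * P^`()).
  rewrite /logdiff !size_comp_poly !deriv_comp comp_polyB !comp_polyM.
  rewrite -!polyC_natr !comp_polyC !polyC_natr !natrM.
  ring.
rewrite size_natmul_poly //.
have [->|W0] := eqVneq (logdiff A B) 0.
  rewrite comp_poly0 mul0r size_poly0 add0n -mulnDl leq_mul2r.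
  by move: AB; slia.
have := size_polyMleq (logdiff A B \Po P) P^`().
have := size_comp_poly_leq (logdiff A B) P.
have := size_deriv_leq P.
move: AB W0; rewrite -size_poly_eq0; slia.
Qed.

(** log (U o A) = deg U * log A + constant + O(1/A).  In terms of logdiff the
    factor X U' - (deg U) U appears, whose leading terms cancel. *)
Lemma agree_comp U A : (0 < deg A)%N -> agree (deg A) (U \Po A) A.
Proof.
move=> A0; rewrite /agree.
have -> : logdiff (U \Po A) A =
    (deg A)%:R * (A^`() * ((('X * U^`()) - (deg U)%:R * U) \Po A)).
  rewrite /logdiff !size_comp_poly !deriv_comp comp_polyB !comp_polyM.
  rewrite -!polyC_natr !comp_polyC !polyC_natr comp_polyX !natrM.
  ring.
rewrite size_natmul_poly // size_comp_poly.
have : (size ('X * U^`() - (deg U)%:R * U)%R <= deg U)%N.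
  apply/leq_sizeP => j jU; rewrite coefB coefXM coef_deriv mulr_natl coefMn.
  case: j jU => [|j] jU /=.
    have -> : deg U = 0%N by slia.
    by rewrite mulr0n subr0.
  have [->|ne] := eqVneq j.+1 (deg U); first by rewrite subrr.
  by rewrite nth_default ?mul0rn ?subrr //; slia.
set V := _ - _ => sV.
have := size_polyMleq A^`() (V \Po A).
have := size_comp_poly_leq V A.
have := size_deriv_leq A.
have [V0|V0] := eqVneq V 0.
  by rewrite V0 comp_poly0 mulr0 size_poly0; slia.
by move: V0; rewrite -size_poly_eq0; slia.
Qed.

(** Any two nonconstant polynomials agree with their own right factor 'X to
    order 1, hence with each other. *)
Lemma agree1 A B : (0 < deg A)%N -> (0 < deg B)%N -> agree 1 A B.
Proof.
have H D : (0 < deg D)%N -> agree 1 D 'X.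
  by move=> D0; have := @agree_comp D 'X; rewrite size_polyX comp_polyXr; apply.
move=> A0 B0; apply: (@agree_trans _ _ 'X); rewrite ?size_polyX //.
  exact: H.
by apply: agree_sym; apply: H.
Qed.

(** If D = A - B had degree d with 0 < d < deg B, then the leading terms of
    D'B - DB' would not cancel, since d differs from deg B, and the degree
    d + deg B - 1 would exceed what agreement allows. *)
Lemma agree_eq_deg_lead A B : (0 < deg A)%N -> deg A = deg B ->
  lead_coef A = lead_coef B -> agree (deg A) A B -> (size (A - B)%R <= 1)%N.
Proof.
move=> A0 dAB lAB; rewrite /agree -dAB leq_add2r => W.
rewrite leqNgt; apply/negP => D1.
set D := A - B in D1.
have DA : (size D <= deg A)%N.
  apply/leq_sizeP => j; rewrite coefB leq_eqVlt => /orP [/eqP<-|jA].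
    by rewrite {2}dAB -!lead_coefE lAB subrr.
  by rewrite !nth_default ?subrr //; slia.
have B0 : (0 < deg B)%N by rewrite -dAB.
have D0 : (0 < deg D)%N by slia.
have := agree1 D0 B0; rewrite /agree => WD.
have E : (deg A - deg D)%:R * (D * B^`()) = logdiff D B - logdiff A B.
  rewrite /logdiff -dAB natrB; last slia.
  by rewrite /D derivB; ring.
have : (size ((deg A - deg D)%:R * (D * B^`()))%R < deg D + deg B)%N.
  rewrite E (leq_ltn_trans (size_polyD _ _)) // gtn_max size_polyN.
  by apply/andP; split; slia.
rewrite size_natmul_poly; last slia.
rewrite size_mul; first by rewrite size_deriv_num; slia.
  by rewrite -size_poly_eq0; slia.
by rewrite -size_poly_eq0 size_deriv_num; slia.
Qed.

(** The derivative of P is periodic of period c, so for c != 0 it takes the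
    same value at all the points 0, c, 2c, ... and is constant. *)
Lemma translate_diff_const P c :
  (size ((P \Po ('X + c%:P)) - P)%R <= 1)%N -> (2 < size P)%N -> c = 0.
Proof.
move=> /size1_polyC; set b := (X in X%:P) => E P3.
have per x : (P^`()).[x + c] = (P^`()).[x].
  have := congr1 (fun q => q^`().[x]) E.
  rewrite derivC derivB deriv_comp derivD derivX derivC addr0 mulr1.
  rewrite horner0 hornerD hornerN horner_comp hornerD hornerX hornerC.
  by move/eqP; rewrite subr_eq0 => /eqP.
have perj j : (P^`()).[c *+ j] = (P^`()).[0].
  by elim: j => [|j IH]; rewrite ?mulr0n // mulrSr per.
apply/eqP; apply: contraT => c0.
pose q := P^`() - (P^`()).[0]%:P.
have q0 : q = 0.
  apply: (@roots_geq_poly_eq0 _ q [seq c *+ j | j <- iota 0 (size q)]).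
  - apply/allP => _ /mapP [j _ ->]; rewrite /root hornerD hornerN hornerC.
    by rewrite perj subrr.
  - rewrite map_inj_uniq ?iota_uniq // => i j /eqP.
    by rewrite -![c *+ _]mulr_natl (inj_eq (mulIf c0)) eqr_nat => /eqP.
  - by rewrite size_map size_iota.
have : (size P^`() <= 1)%N.
  by move/eqP: q0; rewrite subr_eq0 => /eqP ->; rewrite size_polyC; case: eqP.
by rewrite size_deriv_num; slia.
Qed.

End LogarithmicAgreement.
(** * The semigroup generated by a family of polynomials *)

Section Words.
Variables (C : fieldType) (k : nat) (P : 'I_k -> {poly C}).
Implicit Types (u v w : seq 'I_k) (A B : {poly C}) (S T : set {poly C}).

Lemma comp_word_cat u v :
  comp_word P (u ++ v) = comp_word P u \Po comp_word P v.
Proof. by elim: u => [|i u /= ->]; rewrite ?comp_polyX //= comp_polyA. Qed.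

Lemma gen_semigroup_word w : w != [::] -> gen_semigroup P (comp_word P w).
Proof. by move=> /eqP w0; exists w. Qed.

Lemma gen_semigroup_comp : comp_closed (gen_semigroup P).
Proof.
move=> _ _ [u u0 <-] [v v0 <-]; exists (u ++ v); last exact: comp_word_cat.
by case: u u0.
Qed.

Lemma gen_semigroup_gen i : gen_semigroup P (P i).
Proof. by exists [:: i]; rewrite //= comp_polyXr. Qed.

Lemma comp_word_rcons w i :
  comp_word P (rcons w i) = comp_word P w \Po P i.
Proof. by rewrite -cats1 comp_word_cat /= comp_polyXr. Qed.

Lemma gen_semigroup_ind T : comp_closed T -> (forall i, T (P i)) ->
  gen_semigroup P `<=` T.
Proof.
move=> TC TP _ [w w0 <-]; elim: w w0 => // i [|j w] IH _ /=.
  by rewrite comp_polyXr.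
by apply: TC => //; apply: IH.
Qed.

(** If U o X = V o A, then U o X is a left multiple of A and of everything that
    X is a left multiple of. *)
Lemma common_left_multiple_seq S :
  S !=set0 -> comp_closed S ->
  (forall A B, S A -> S B ->
     exists U V, [/\ S U, S V & U \Po A = V \Po B]) ->
  forall s : seq {poly C}, (forall A, A \in s -> S A) ->
  exists2 X, S X & forall A, A \in s -> principal_right_ideal S A X.
Proof.
move=> [X0 SX0] SC clm; elim=> [|A s IH] sS; first by exists X0.
have [B Bs|X SX Xs] := IH; first by apply: sS; rewrite inE Bs orbT.
have SA : S A by apply: sS; rewrite mem_head.
have [U [V [SU SV E]]] := clm _ _ SX SA.
exists (U \Po X) => [|B]; first exact: SC.
rewrite inE => /orP [/eqP ->|/Xs [D SD <-]]; first by exists V; rewrite // E.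
by exists (U \Po D); [exact: SC|rewrite comp_polyA].
Qed.

Hypothesis P_deg : forall i, (2 <= deg (P i))%N.

Lemma deg_comp_word w : (size w < deg (comp_word P w))%N.
Proof.
elim: w => [|i w IH] /=; first by rewrite size_polyX.
by rewrite size_comp_poly; have := P_deg i; slia.
Qed.

Lemma gen_semigroup_deg A : gen_semigroup P A -> (1 < deg A)%N.
Proof. by move=> [[|i w] // _ <-]; have := deg_comp_word (i :: w) => /=; slia. Qed.

End Words.

(** * Elements of S are determined by degree and leading coefficient *)

Section Rigidity.
Variables (K : numFieldType) (k : nat) (P : 'I_k -> {poly K}).
Hypothesis P_deg : forall i, (2 <= deg (P i))%N.
Variable F : {poly K}.
Hypothesis F_common : forall i, principal_right_ideal (gen_semigroup P) (P i) F.
Local Notation S := (gen_semigroup P).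

(** The bootstrap.  All elements of large degree are compared with the single
    polynomial G o F, which ends in every generator at once. *)
Lemma gen_semigroup_agree r A B :
  S A -> S B -> (r <= deg A)%N -> (r <= deg B)%N -> agree r A B.
Proof.
elim: r A B => [|r IH] A B SA SB rA rB.
  apply: (@agree_leq _ _ 1) => //.
  by apply: agree1; have := gen_semigroup_deg P_deg; [move/(_ _ SA)|move/(_ _ SB)]; slia.
have [r0|r_gt0] := posnP r.
  rewrite r0.
  by apply: agree1; have := gen_semigroup_deg P_deg; [move/(_ _ SA)|move/(_ _ SB)]; slia.
have [i0 _] : exists i0 : 'I_k, True.
  by case: SA => -[|i w] // _ _; exists i.
(* G only has to be an element of S of degree at least r, so that the
   induction hypothesis applies to G o A however short the word A is. *)
pose G := comp_word P (nseq r i0).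
have SG : S G by apply: gen_semigroup_word; case: (r) r_gt0.
have rG : (r < deg G)%N.
  by have := deg_comp_word P_deg (nseq r i0); rewrite size_nseq.
have toF D : S D -> (r < deg D)%N -> agree r.+1 D (G \Po F).
  move=> SD rD; have D0 : (0 < deg D)%N by slia.
  apply: (@agree_trans _ _ _ (G \Po D)); rewrite ?size_comp_poly //; first slia.
    by apply: agree_sym; apply: agree_leq rD _; apply: agree_comp.
  case: SD => w w0 wD; case/lastP: w w0 wD => // w i _; rewrite comp_word_rcons => <-.
  have [U SU <-] := F_common i.
  rewrite !comp_polyA.
  have Gw : S (G \Po comp_word P w).
    case: SG => g g0 <-; rewrite -comp_word_cat; apply: gen_semigroup_word.
    by case: (g) g0.
  have GU := gen_semigroup_comp SG SU.
  have n2 := P_deg i; have w1 := deg_comp_word P_deg w.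
  have U1 := gen_semigroup_deg P_deg SU.
  have UG : agree r (G \Po comp_word P w) (G \Po U).
    by apply: IH; rewrite // size_comp_poly; slia.
  by apply: agree_leq (agree_precomp _ UG); slia.
apply: agree_trans (toF _ SA rA) (agree_sym (toF _ SB rB)) => //.
rewrite size_comp_poly; have [U SU <-] := F_common i0.
rewrite size_comp_poly muln_gt0 muln_gt0.
by have := gen_semigroup_deg P_deg SU; have := P_deg i0; slia.
Qed.

(** Agreement to order deg A leaves A - B = c constant.  The same applies to
    P_i o A and P_i o B, so P_i(X + c) - P_i(X) is constant as well, which
    forces c = 0 because P_i is not affine. *)
Lemma gen_semigroup_rigid A B :
  S A -> S B -> deg A = deg B -> lead_coef A = lead_coef B -> A = B.
Proof.
have const X Y : S X -> S Y -> deg X = deg Y -> lead_coef X = lead_coef Y ->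
    (size (X - Y)%R <= 1)%N.
  move=> SX SY dXY lXY; apply: agree_eq_deg_lead => //.
    by have := gen_semigroup_deg P_deg SX; slia.
  by apply: gen_semigroup_agree => //; rewrite dXY.
move=> SA SB dAB lAB.
have /size1_polyC := const _ _ SA SB dAB lAB.
set c := (X in X%:P) => Ec.
have [i _] : exists i : 'I_k, True.
  by case: SA => -[|i w] // _ _; exists i.
have SPA := gen_semigroup_comp (gen_semigroup_gen P i) SA.
have SPB := gen_semigroup_comp (gen_semigroup_gen P i) SB.
have A1 := gen_semigroup_deg P_deg SA; have B1 := gen_semigroup_deg P_deg SB.
have := const _ _ SPA SPB.
have sA : (1 < size A)%N by slia.
have sB : (1 < size B)%N by slia.
rewrite !size_comp_poly !lead_coef_comp //.
rewrite dAB lAB => /(_ erefl erefl) PAB.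
have AE : A = B + c%:P by rewrite -Ec addrC subrK.
rewrite AE; suff -> : c = 0 by rewrite addr0.
apply: (@translate_diff_const _ (P i)); last by have := P_deg i; slia.
have E : (P i \Po A) - (P i \Po B) = ((P i \Po ('X + c%:P)) - P i) \Po B.
  by rewrite comp_polyB -comp_polyA comp_polyD comp_polyX comp_polyC -AE.
move: PAB; rewrite E.
have := size_comp_poly ((P i \Po ('X + c%:P)) - P i) B.
by slia.
Qed.

End Rigidity.
(** * Words of expanding affine maps *)

Section AffineWords.
Variables (k : nat) (n : 'I_k -> nat).
Hypothesis n_ge2 : forall i, (2 <= n i)%N.
Implicit Types (u v w : seq 'I_k).

Definition word_deg w : nat := foldr (fun i m => (n i * m)%N) 1%N w.

(** The coefficient of the unknown g l in the constant term of the affine map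
    of w, where the letter i acts by x |-> n i * x + g i; it is also the
    exponent of the l-th leading coefficient in the leading coefficient of a
    composition. *)
Definition word_exp w : 'I_k -> nat :=
  foldr (fun i a l => ((i == l) + n i * a l)%N) (fun=> 0%N) w.

Variables (R : realFieldType) (g : 'I_k -> R).

Definition affine_word w (x : R) : R :=
  foldr (fun i y => (n i)%:R * y + g i) x w.

Lemma affine_wordE w x :
  affine_word w x = (word_deg w)%:R * x + \sum_l (word_exp w l)%:R * g l.
Proof.
elim: w => [|i w /= ->]; first by rewrite big1 ?addr0 ?mul1r // => l _; rewrite mul0r.
rewrite [X in _ = _ + X](_ : _ = \sum_l ((i == l)%:R * g l
    + (n i)%:R * ((word_exp w l)%:R * g l))); last first.
  by apply: eq_bigr => l _; rewrite natrD natrM mulrDl mulrA.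
rewrite big_split /= -mulr_sumr natrM.
have -> : \sum_l (i == l)%:R * g l = g i.
  rewrite (bigD1 i) //= eqxx mul1r big1 ?addr0 // => l /negbTE.
  by rewrite eq_sym => ->; rewrite mul0r.
by ring.
Qed.

Lemma word_deg_gt0 w : (0 < word_deg w)%N.
Proof. by elim: w => //= i w IH; rewrite muln_gt0 IH; have := n_ge2 i; lia. Qed.

(** The fixed point of the letter i. *)
Let pt i : R := - g i / ((n i)%:R - 1).

Let n_gt1 i : 1 < (n i)%:R :> R.
Proof. by rewrite ltr1n. Qed.

Let stepE i x : (n i)%:R * x + g i = (n i)%:R * (x - pt i) + pt i.
Proof. by rewrite /pt; field; rewrite subr_eq0 gt_eqF. Qed.

(** Every letter expands away from its fixed point, so a point to the left of
    all fixed points can only move further to the left. *)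
Lemma affine_word_lt w a x : (forall i, a <= pt i) -> x < a -> affine_word w x < a.
Proof.
move=> ap xa; elim: w => //= i w IH; rewrite stepE.
by have := ap i; have := n_gt1 i; move: IH; nra.
Qed.

Lemma affine_word_gt w b x : (forall i, pt i <= b) -> b < x -> b < affine_word w x.
Proof.
move=> ap xa; elim: w => //= i w IH; rewrite stepE.
by have := ap i; have := n_gt1 i; move: IH; nra.
Qed.

(** Let a and b be the extreme fixed points, and F the common map, which takes
    the values a and b at some x < y.  Points outside [a, b] never come back, so
    the last letter of each word maps x and y into [a, b]; for the letter that
    fixes a this gives 2 (y - a) <= b - a, and for the letter that fixes b it
    gives 2 (b - x) <= b - a.  Hence y <= x, unless a = b. *)
Lemma affine_word_common (u : 'I_k -> seq 'I_k) :
  (forall i j, affine_word (rcons (u i) i) =1 affine_word (rcons (u j) j)) ->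
  forall i j, g i * ((n j)%:R - 1) = g j * ((n i)%:R - 1).
Proof.
move=> uE i j.
have [i0 _ minp] := @arg_minP _ _ 'I_k i xpredT pt isT.
have [i1 _ maxp] := @arg_maxP _ _ 'I_k i xpredT pt isT.
have {}minp l : pt i0 <= pt l by exact: minp.
have {}maxp l : pt l <= pt i1 by exact: maxp.
have last_in l x : pt i0 <= affine_word (rcons (u l) l) x <= pt i1 ->
    pt i0 <= (n l)%:R * x + g l <= pt i1.
  have -> : affine_word (rcons (u l) l) x = affine_word (u l) ((n l)%:R * x + g l).
    by rewrite /affine_word foldr_rcons.
  move=> /andP [h0 h1]; apply/andP; split; rewrite leNgt; apply/negP => h.
    by have := affine_word_lt (u l) minp h; rewrite ltNge h0.
  by have := affine_word_gt (u l) maxp h; rewrite ltNge h1.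
have pt_eq : pt i0 = pt i1.
  apply/eqP; rewrite eq_le minp /= leNgt; apply/negP => lt01.
  have solve y : exists x, forall l, affine_word (rcons (u l) l) x = y.
    pose N : R := (word_deg (rcons (u i) i))%:R.
    have N0 : N != 0 by rewrite pnatr_eq0 -lt0n word_deg_gt0.
    exists ((y - affine_word (rcons (u i) i) 0) / N) => l.
    rewrite (uE l i) !affine_wordE -/N; field; exact: N0.
  have [x xE] := solve (pt i0); have [y yE] := solve (pt i1).
  have lxy : x < y.
    have := yE i; have := xE i; rewrite !affine_wordE.
    have : 0 < (word_deg (rcons (u i) i))%:R :> R by rewrite ltr0n word_deg_gt0.
    by move: lt01; nra.
  have := last_in i0 y; rewrite yE lexx ltW // => /(_ isT)/andP [_ hy].
  have := last_in i1 x; rewrite xE lexx ltW // => /(_ isT)/andP [hx _].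
  have half (m : nat) (t s : R) : (2 <= m)%N -> 0 < s -> m%:R * t <= s -> 2 * t <= s.
    rewrite -(ler_nat R) => m2 s0 mt; have [t0|t0] := lerP 0 t; last lra.
    by apply: le_trans mt; rewrite ler_wpM2r.
  have s0 : 0 < pt i1 - pt i0 by rewrite subr_gt0.
  have := half _ (y - pt i0) _ (n_ge2 i0) s0.
  have := half _ (pt i1 - x) _ (n_ge2 i1) s0.
  move: hx hy; rewrite !stepE; move: (pt i0) (pt i1) (n i0)%:R (n i1)%:R lxy => a b m0 m1.
  move=> lxy hx hy H1 H2.
  have {}H1 : 2 * (b - x) <= b - a by apply: H1; lra.
  have {}H2 : 2 * (y - a) <= b - a by apply: H2; lra.
  lra.
have : pt i = pt j.
  by apply/eqP; rewrite eq_le; have := minp i; have := maxp i; have := minp j;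
    have := maxp j; rewrite pt_eq; lra.
move: (n_gt1 i) (n_gt1 j); rewrite /pt => ni nj E.
have {1}-> : g i = - (- g i / ((n i)%:R - 1)) * ((n i)%:R - 1).
  by field; lra.
by rewrite E; field; lra.
Qed.

End AffineWords.

(** * From rational to multiplicative relations *)

Section IntegerRelations.
Variables (r k : nat) (M : 'I_r -> 'I_k -> int) (e : 'I_k -> int).
Hypothesis Me : forall g : 'I_k -> rat,
  (forall j, \sum_l (M j l)%:~R * g l = 0) -> \sum_l (e l)%:~R * g l = 0.

(** A linear form that vanishes on the common kernel of others is a rational
    combination of them; the denominators are cleared. *)
Lemma integer_combination : exists (d : nat) (z : 'I_r -> int),
  (0 < d)%N /\ forall l, d%:Z * e l = \sum_j z j * M j l.
Proof.
pose Mx : 'M[rat]_(r, k) := \matrix_(j, l) (M j l)%:~R.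
pose ex : 'rV[rat]_k := \row_l (e l)%:~R.
have MxE j l : Mx j l = (M j l)%:~R by rewrite mxE.
have : (ex <= Mx)%MS.
  rewrite submxE; apply/eqP/rowP => c; rewrite !mxE.
  under eq_bigr do rewrite mxE.
  apply: (Me (g := fun l => cokermx Mx l c)) => j.
  have := congr1 (fun X : 'M_(r, k) => X j c) (mulmx_coker Mx).
  by rewrite mxE [RHS]mxE => E; rewrite -[RHS]E; apply: eq_bigr => l _; rewrite MxE.
case/submxP => D exD.
pose q j : int := denq (D 0 j).
have q0 j : 0 < q j by apply: denq_gt0.
have pq0 : 0 < \prod_j q j by apply: prodr_gt0.
exists `|(\prod_j q j)%R|%N, (fun j => (numq (D 0 j) * \prod_(i | i != j) q i)%R).
split; first by rewrite absz_gt0 gt_eqF.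
move=> l; apply: (@intr_inj rat).
rewrite gtz0_abs // intrM rmorph_sum /=.
have := congr1 (fun X : 'rV_k => X 0 l) exD; rewrite !mxE => ->.
rewrite mulr_sumr; apply: eq_bigr => j _.
rewrite !mxE !intrM (bigD1 j) //= intrM numqE.
by rewrite -/(q j); ring.
Qed.

(** A linear consequence over rat survives in the multiplicative group of a
    field up to torsion. *)
Lemma multiplicative_consequence (K : fieldType) (c : 'I_k -> K) :
  (forall l, c l != 0) -> (forall j, \prod_l c l ^ M j l = 1) ->
  exists2 d : nat, (0 < d)%N & (\prod_l c l ^ e l) ^+ d = 1.
Proof.
move=> c0 cM; have [d [z [d0 E]]] := integer_combination.
exists d => //; rewrite -prodrXl.
transitivity (\prod_l \prod_j (c l ^ M j l) ^ z j).
  apply: eq_bigr => l _; rewrite exprnP exprz_exp mulrC E.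
  elim/big_ind2: _ => [|x1 x2 y1 y2 <- <-|j _] //; first by rewrite expfzDr.
  by rewrite mulrC exprz_exp.
rewrite exchange_big /= big1 // => j _.
rewrite -[RHS](exp1rz _ (z j)) -(cM j).
by elim/big_ind2: _ => [|x1 x2 y1 y2 -> ->|l _]; rewrite ?exp1rz ?expfzMl.
Qed.

End IntegerRelations.
(** * Common left multiples in semigroups of monomials *)

Section Monomials.
Variable K : fieldType.
Implicit Types (a b x : K) (A B : {poly K}) (S : set {poly K}).

Lemma monomial_comp a b m n :
  (a *: 'X^m) \Po (b *: 'X^n) = (a * b ^+ m) *: 'X^(m * n) :> {poly K}.
Proof.
by rewrite comp_polyZ comp_Xn_poly exprZn -exprM scalerA mulnC.
Qed.

Lemma is_root_of_unityP x :
  is_root_of_unity x <-> exists2 L, (0 < L)%N & x ^+ L = 1.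
Proof.
by split=> -[L L0 xL]; exists L => //; apply/unity_rootP.
Qed.

Lemma is_root_of_unity_comp a b m :
  is_root_of_unity a -> is_root_of_unity b -> is_root_of_unity (a * b ^+ m).
Proof.
move=> /is_root_of_unityP [L L0 aL] /is_root_of_unityP [M M0 bM].
apply/is_root_of_unityP; exists (L * M)%N; first by rewrite muln_gt0 L0.
rewrite exprMn exprM aL expr1n mul1r exprAC [(L * M)%N]mulnC exprM bM.
by rewrite !expr1n.
Qed.

Lemma ZU_comp_closed : comp_closed (ZU K).
Proof.
move=> _ _ [a [m [aU m0 ->]]] [b [n [bU n0 ->]]].
exists (a * b ^+ m), (m * n)%N; split; last exact: monomial_comp.
  exact: is_root_of_unity_comp.
by rewrite muln_gt0 m0.
Qed.

(** Pigeonhole on the residues of N^0, ..., N^L. *)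
Lemma eventually_periodic_expn N L : (0 < L)%N ->
  exists s r, (0 < r)%N /\ N ^ (s + r) = N ^ s %[mod L].
Proof.
move=> L0; pose f (i : 'I_L.+1) : 'I_L := Ordinal (ltn_pmod (N ^ i) L0).
have : ~~ injectiveb f.
  by apply/injectiveP => /leq_card; rewrite !card_ord ltnn.
case/injectivePn => i [j ne /(congr1 val) /= E].
wlog lt : i j ne E / (i < j)%N.
  move=> H; case: (ltngtP i j) => ij; first exact: (H i j).
    by apply: (H j i) => //; rewrite eq_sym.
  by case/eqP: ne; apply: val_inj.
by exists i, (j - i)%N; rewrite subn_gt0 lt subnKC // ltnW.
Qed.


(** The iterate of order r + 1, so that it is a composition of at least one
    factor A. *)
Definition comp_power A r : {poly K} := iter r (fun X => A \Po X) A.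

Lemma comp_power_closed S A r : comp_closed S -> S A -> S (comp_power A r).
Proof. by move=> SC SA; elim: r => //= r IH; apply: SC. Qed.

Lemma comp_power_right_ideal S A B r : comp_closed S -> S A -> S B ->
  principal_right_ideal S B (comp_power (A \Po B) r).
Proof.
move=> SC SA SB; elim: r => [|r [Z SZ ZE]]; first by exists A.
exists ((A \Po B) \Po Z); first by do 2!apply: (SC) => //.
by rewrite -comp_polyA ZE.
Qed.

Section AbstractMonomials.
Variables (S : set {poly K}) (phi : {poly K} -> {poly K}).
Hypothesis SC : comp_closed S.
Hypothesis phiM : forall A B, S A -> S B -> phi (A \Po B) = phi A \Po phi B.

Lemma monomial_comp_power A a N L r : S A -> phi A = a *: 'X^N -> a ^+ L = 1 ->
  exists2 e, e ^+ L = 1 & phi (comp_power A r) = e *: 'X^(N ^ r.+1).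
Proof.
move=> SA phA aL; elim: r => [|r [e eL IH]]; first by exists a; rewrite // expn1.
exists (a * e ^+ N); first by rewrite exprMn aL mul1r exprAC eL expr1n.
rewrite [comp_power _ _]/= phiM ?phA ?IH ?monomial_comp -?expnS //.
exact: comp_power_closed.
Qed.

Hypothesis phi_inj : {in S &, injective phi}.
Hypothesis phi_ZU : forall A, S A -> ZU K (phi A).

(** Let X and Y be the same iterates, of degree N^(r+1), of A o B and B o A.  In
    D o X o Y and D o Y o X the coefficients e of X and f of Y enter as
    (e f^M)^Q and (f e^M)^Q with M = N^(r+1) and Q = deg D = N^(s+1).  If
    M Q = Q modulo the order of e and f, both are (e f)^Q.  Finally X ends in B
    and Y ends in A. *)
Lemma monomial_common_left_multiple A B : S A -> S B ->
  exists U V, [/\ S U, S V & U \Po A = V \Po B].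
Proof.
move=> SA SB.
have [a [m [/is_root_of_unityP [La La0 aL] m0 phA]]] := phi_ZU SA.
have [b [n [/is_root_of_unityP [Lb Lb0 bL] n0 phB]]] := phi_ZU SB.
pose L := (La * Lb)%N; pose N := (m * n)%N.
have L0 : (0 < L)%N by rewrite muln_gt0 La0.
have {}aL : a ^+ L = 1 by rewrite exprM aL expr1n.
have {}bL : b ^+ L = 1 by rewrite /L mulnC exprM bL expr1n.
have [s [r0 [r0_gt0 sr]]] := eventually_periodic_expn N L0.
case: r0 r0_gt0 sr => // r _ sr.
have SAB : S (A \Po B) by exact: SC.
have SBA : S (B \Po A) by exact: SC.
have phAB : phi (A \Po B) = (a * b ^+ m) *: 'X^N by rewrite phiM // phA phB monomial_comp.
have phBA : phi (B \Po A) = (b * a ^+ n) *: 'X^N.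
  by rewrite phiM // phA phB monomial_comp mulnC.
have abL : (a * b ^+ m) ^+ L = 1 by rewrite exprMn aL mul1r exprAC bL expr1n.
have baL : (b * a ^+ n) ^+ L = 1 by rewrite exprMn bL mul1r exprAC aL expr1n.
pose D := comp_power (A \Po B) s.
pose X := comp_power (A \Po B) r; pose Y := comp_power (B \Po A) r.
have SD : S D by exact: comp_power_closed.
have SX : S X by exact: comp_power_closed.
have SY : S Y by exact: comp_power_closed.
have [h hL phD] := monomial_comp_power s SAB phAB abL.
have [e eL phX] := monomial_comp_power r SAB phAB abL.
have [f fL phY] := monomial_comp_power r SBA phBA baL.
have [U SU UE] := comp_power_right_ideal r SC SB SA.
have [V SV VE] := comp_power_right_ideal r SC SA SB.
exists ((D \Po X) \Po U), ((D \Po Y) \Po V); split; do ?exact/SC/SV/SC;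
  do ?exact/SC/SU/SC.
rewrite -!(comp_polyA _ _ A) -!(comp_polyA _ _ B) UE VE -/X -/Y.
have SDXY : S ((D \Po X) \Po Y) by do 2!apply: (SC) => //.
have SDYX : S ((D \Po Y) \Po X) by do 2!apply: (SC) => //.
apply: phi_inj; [exact: mem_set|exact: mem_set|].
rewrite -!comp_polyA !phiM //; try exact: SC.
rewrite phD phX phY !monomial_comp; congr (_ * _ *: _).
have absorb x : x ^+ L = 1 -> (x ^+ (N ^ r.+1)) ^+ (N ^ s.+1) = x ^+ (N ^ s.+1).
  move=> xL; rewrite -exprM -expnD addnC addSn expnS [in RHS]expnS.
  by rewrite -(expr_mod _ xL) -modnMmr sr modnMmr expr_mod.
by rewrite !exprMn !absorb // mulrC.
Qed.

End AbstractMonomials.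
End Monomials.
(** * Leading coefficients up to torsion *)

Section LeadingCoefficients.
Variables (K : numFieldType) (k : nat) (P : 'I_k -> {poly K}).
Hypothesis P_deg : forall i, (2 <= deg (P i))%N.
Implicit Types (w : seq 'I_k) (i j l : 'I_k).
Local Notation n := (fun i => deg (P i)).
Local Notation S := (gen_semigroup P).

Lemma deg_comp_wordE w : deg (comp_word P w) = word_deg n w.
Proof. by elim: w => [|i w IH]; rewrite /= ?size_polyX // size_comp_poly IH. Qed.

Lemma lead_coef_comp_word w :
  lead_coef (comp_word P w) = \prod_l lead_coef (P l) ^+ word_exp n w l.
Proof.
elim: w => [|i w IH] /=; first by rewrite lead_coefX big1.
have w1 : (1 < size (comp_word P w))%N by have := deg_comp_word P_deg w; slia.
rewrite lead_coef_comp // IH -prodrXl.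
have -> : lead_coef (P i) = \prod_l lead_coef (P l) ^+ (i == l).
  rewrite (bigD1 i) //= eqxx expr1 big1 ?mulr1 // => l /negbTE.
  by rewrite eq_sym => ->.
rewrite -big_split /=; apply: eq_bigr => l _.
by rewrite exprD mulnC exprM.
Qed.

Lemma lead_coef_gen_neq0 i : lead_coef (P i) != 0.
Proof. by rewrite lead_coef_eq0; apply: contraL (P_deg i) => /eqP->; rewrite size_poly0. Qed.

(** Rationally, the equations saying that all the words for F have the same
    exponents imply that the affine maps x |-> n i * x + g i share their fixed
    point; multiplicatively this is the same relation up to torsion. *)
Lemma lead_coef_torsion (F : {poly K}) :
  (forall i, principal_right_ideal S (P i) F) ->
  forall i j, exists2 d, (0 < d)%N &
    (lead_coef (P i) ^+ (n j).-1) ^+ d = (lead_coef (P j) ^+ (n i).-1) ^+ d.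
Proof.
move=> FP i j.
have [v vF] : exists v : 'I_k -> seq 'I_k, forall l, comp_word P (rcons (v l) l) = F.
  apply: (fin_all_exists (P := fun l v => comp_word P (rcons v l) = F)) => l.
  by have [_ [v _ <-] <-] := FP l; exists v; rewrite comp_word_rcons.
pose a l : 'I_k -> nat := word_exp n (rcons (v l) l).
(* Row l: the word for F ending in l against the word ending in i. *)
pose M (l m : 'I_k) : int := (a l m)%:Z - (a i m)%:Z.
pose e (l : 'I_k) : int :=
  ((i == l) * (n j).-1)%N%:Z - ((j == l) * (n i).-1)%N%:Z.
have c0 := lead_coef_gen_neq0.
have prod_delta (l : 'I_k) m :
    \prod_t lead_coef (P t) ^ ((l == t) * m)%N%:Z = lead_coef (P l) ^+ m.
  rewrite (bigD1 l) //= eqxx mul1n big1 ?mulr1 // => t /negbTE.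
  by rewrite eq_sym => ->; rewrite mul0n.
have sum_delta (g : 'I_k -> rat) (l : 'I_k) m :
    \sum_t (((l == t) * m)%N%:Z)%:~R * g t = m%:R * g l.
  rewrite (bigD1 l) //= eqxx mul1n big1 ?addr0 // => t /negbTE.
  by rewrite eq_sym => ->; rewrite mul0n mul0r.
have Me (g : 'I_k -> rat) : (forall l, \sum_m (M l m)%:~R * g m = 0) ->
    \sum_m (e m)%:~R * g m = 0.
  move=> Mg.
  have aE l : \sum_m (a l m)%:R * g m = \sum_m (a i m)%:R * g m.
    have := Mg l; under eq_bigr do rewrite /M intrB mulrBl.
    by rewrite sumrB => /eqP; rewrite subr_eq0 => /eqP.
  have H : g i * ((n j)%:R - 1) = g j * ((n i)%:R - 1).
    apply: (affine_word_common P_deg (u := v)) => l m x.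
    rewrite !affine_wordE -!deg_comp_wordE !vF; congr (_ + _).
    by rewrite aE [RHS]aE.
  rewrite /e; under eq_bigr do rewrite intrB mulrBl.
  have pred1 l : (n l).-1%:R = (n l)%:R - 1 :> rat.
    by have := P_deg l; case: (n l) => // m _; rewrite mulrSr addrK.
  by rewrite sumrB !sum_delta !pred1 mulrC H mulrC subrr.
have [|d d0 dE] := multiplicative_consequence Me c0.
  move=> l; under eq_bigr do rewrite expfzDr // -invr_expz.
  have lcF m : \prod_t lead_coef (P t) ^ (a m t)%:Z = lead_coef F.
    by rewrite -(vF m) lead_coef_comp_word.
  rewrite big_split /= lcF prodfV lcF mulfV // -(lcF i).
  by apply/prodf_neq0 => t _; rewrite expfz_neq0.
exists d => //; move: dE.
under eq_bigr do rewrite /e expfzDr // -invr_expz.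
rewrite big_split /= prodfV !prod_delta exprMn exprVn => /(canRL (mulfVK _)).
by rewrite mul1r => -> //; rewrite !expf_neq0.
Qed.

End LeadingCoefficients.

(** * The top monomial as an isomorphism *)

Section Linearization.
Variables (K : numClosedFieldType) (k : nat) (P : 'I_k -> {poly K}).
Hypothesis P_deg : forall i, (2 <= deg (P i))%N.
Local Notation S := (gen_semigroup P).

(** The leading term of A conjugated by the homothety z |-> lam z. *)
Definition top_monomial (lam : K) (A : {poly K}) : {poly K} :=
  (lam ^+ (deg A).-1 * lead_coef A) *: 'X^(deg A).

Lemma top_monomial_comp lam (A B : {poly K}) : (0 < deg A)%N -> (0 < deg B)%N ->
  top_monomial lam (A \Po B) = top_monomial lam A \Po top_monomial lam B.
Proof.
move=> A0 B0; rewrite /top_monomial monomial_comp size_comp_poly.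
rewrite lead_coef_comp; last by slia.
congr (_ *: _); rewrite exprMn -exprM mulrACA -exprD; congr (lam ^+ _ * _).
by slia.
Qed.

(** The homothety making P_i0 monic up to conjugation works for every
    generator, because lead_coef_torsion compares each of them with P_i0. *)
Lemma rescale_to_roots_of_unity (i0 : 'I_k) (F : {poly K}) :
  (forall i, principal_right_ideal S (P i) F) ->
  exists2 lam : K, lam != 0 &
    forall i, is_root_of_unity (lam ^+ (deg (P i)).-1 * lead_coef (P i)).
Proof.
move=> FP; pose n i := deg (P i); have n2 i : (2 <= n i)%N := P_deg i.
have c0 := lead_coef_gen_neq0 P_deg.
have m0 : (0 < (n i0).-1)%N by have := n2 i0; lia.
pose lam := (n i0).-1.-root (lead_coef (P i0))^-1.
have lamE : lam ^+ (n i0).-1 = (lead_coef (P i0))^-1 by rewrite rootCK.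
exists lam => [|i].
  by apply: contra_eq_neq lamE => ->; rewrite expr0n gtn_eqF //= eq_sym invr_eq0.
have [d d0 dE] := lead_coef_torsion P_deg FP i i0.
apply/is_root_of_unityP; exists ((n i0).-1 * d)%N; first by rewrite muln_gt0 m0.
rewrite exprMn [X in _ * X]exprM dE -!exprM mulnCA exprM lamE.
by rewrite exprVn mulVf // expf_neq0.
Qed.

Lemma common_left_multiple_linearizes (i0 : 'I_k) (F : {poly K}) :
  (forall i, principal_right_ideal S (P i) F) ->
  exists T, subsemigroup T (ZU K) /\ semigroup_isomorphic S T.
Proof.
move=> FP; have [lam lam0 lamU] := rescale_to_roots_of_unity i0 FP.
pose phi := top_monomial lam.
have S1 A : S A -> (0 < deg A)%N.
  by move=> SA; have := gen_semigroup_deg P_deg SA; slia.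
have phiM A B : S A -> S B -> phi (A \Po B) = phi A \Po phi B.
  by move=> SA SB; apply: top_monomial_comp; apply: S1.
have SZ A : S A -> S A /\ ZU K (phi A).
  apply: (gen_semigroup_ind (T := fun A => S A /\ ZU K (phi A))) => [X Y|i].
    move=> [SX ZX] [SY ZY]; split; first exact: gen_semigroup_comp.
    by rewrite phiM //; apply: ZU_comp_closed.
  split; first exact: gen_semigroup_gen.
  exists (lam ^+ (deg (P i)).-1 * lead_coef (P i)), (deg (P i)); split => //.
  by have := P_deg i; lia.
exists (phi @` S); split.
  split.
  - by exists (phi (P i0)), (P i0) => //; apply: gen_semigroup_gen.
  - by move=> _ [A SA <-]; case: (SZ A SA).
  - move=> _ _ [A SA <-] [B SB <-]; exists (A \Po B); last exact: phiM.
    exact: gen_semigroup_comp.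
exists phi; split => //; split; first by move=> A SA; exists A.
  move=> A B /set_mem SA /set_mem SB E.
  have nz X : S X -> lam ^+ (deg X).-1 * lead_coef X != 0.
    move=> SX; rewrite mulf_neq0 ?expf_neq0 // lead_coef_eq0.
    by apply: contraL (S1 _ SX) => /eqP ->; rewrite size_poly0.
  have dAB : deg A = deg B.
    have := congr1 (fun X : {poly K} => size X) E.
    by rewrite /phi /top_monomial !size_scale ?nz // !size_polyXn => -[].
  apply: (gen_semigroup_rigid P_deg FP) => //.
  have := congr1 lead_coef E.
  rewrite /phi /top_monomial !lead_coefZ !lead_coefXn !mulr1 dAB.
  by apply: mulfI; rewrite expf_neq0.
by move=> _ [A SA <-]; exists A.
Qed.

End Linearization.

Theorem theorem1p1 (R : realType) (k : nat) (k_gt0 : (0 < k)%N)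
    (P : 'I_k -> {poly R[i]%C}) (P_deg : forall i, (2 <= (size (P i)).-1)%N) :
  (exists T : set {poly R[i]%C},
      subsemigroup T (ZU R[i]%C) /\
      semigroup_isomorphic (gen_semigroup P) T) <->
  \bigcap_(i in [set: 'I_k]) principal_right_ideal (gen_semigroup P) (P i)
    !=set0.
Proof.
pose i0 := Ordinal k_gt0; split => [[T [[_ TZ _] [phi [[phiT phi_inj _] phiM]]]]|[F FP]].
  have SC := @gen_semigroup_comp _ _ P.
  have clm := monomial_common_left_multiple SC phiM phi_inj (fun A SA => TZ _ (phiT A SA)).
  have S0 : gen_semigroup P !=set0 by exists (P i0); apply: gen_semigroup_gen.
  have sS A : A \in codom P -> gen_semigroup P A.
    by case/codomP => i ->; apply: gen_semigroup_gen.
  have [X _ XP] := common_left_multiple_seq S0 SC clm sS.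
  by exists X => i _; apply: XP; apply: codom_f.
by apply: (common_left_multiple_linearizes P_deg i0 (F := F)) => i; apply: FP.
Qed.
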